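(* Consider the translation of $\mathsf{CL}_{\rm b}$ to $\mathsf{CLL}_{\rm b}$ obtained by composing the Gödel-Gentzen translation $(\cdot)^{\rm G}$ with Girard's call-by-name translation $(\cdot)^\circ$, i.e. $A\mapsto(A^{\rm G})^\circ$. This composition can be presented in a modular (and simpler) way as $A\mapsto\,!A_{{\rm G}\circ}$, i.e. for every formula $A$ of the language of $\mathsf{ILL}_\bot$ the formulas $(A^{\rm G})^\circ$ and $!A_{{\rm G}\circ}$ are provably equivalent in $\mathsf{CLL}_{\rm b}$, where $A_{{\rm G}\circ}$ is defined inductively by: $P_{{\rm G}\circ}:=\,?!P$ for $P$ atomic; $(A\otimes B)_{{\rm G}\circ}:=\,!A_{{\rm G}\circ}\otimes\,!B_{{\rm G}\circ}$; $(A\& B)_{{\rm G}\circ}:=A_{{\rm G}\circ}\& B_{{\rm G}\circ}$; $(A\oplus B)_{{\rm G}\circ}:=\,?(!A_{{\rm G}\circ}\oplus\,!B_{{\rm G}\circ})$; $(A\multimap B)_{{\rm G}\circ}:=\,!A_{{\rm G}\circ}\multimap B_{{\rm G}\circ}$; $(\forall xA)_{{\rm G}\circ}:=\forall xA_{{\rm G}\circ}$; $(\exists xA)_{{\rm G}\circ}:=\,?\exists x\,!A_{{\rm G}\circ}$; $(!A)_{{\rm G}\circ}:=\,!A_{{\rm G}\circ}$.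
   Context: Intuitionistic linear logic $\mathsf{ILL}$ (first order). Formulas are built from atomic formulas, including the constants $1,\top,0$, using $\otimes,\&,\oplus,\multimap$, $\forall x,\exists x$ and $!$. Sequents are $\Gamma\vdash A$ with $\Gamma$ a finite multiset of formulas and exactly one formula on the right. Axioms: $A\vdash A$; $\vdash 1$; $\Gamma\vdash\top$; $\Gamma,0\vdash C$. Rules (premises $\Rightarrow$ conclusion): (cut) $\Gamma\vdash A;\ \Delta,A\vdash C\Rightarrow\Gamma,\Delta\vdash C$; $\Gamma\vdash C\Rightarrow\Gamma,1\vdash C$; $\Gamma\vdash A;\ \Delta\vdash B\Rightarrow\Gamma,\Delta\vdash A\otimes B$; $\Gamma,A,B\vdash C\Rightarrow\Gamma,A\otimes B\vdash C$; $\Gamma,A\vdash B\Rightarrow\Gamma\vdash A\multimap B$; $\Gamma\vdash A;\ \Delta,B\vdash C\Rightarrow\Gamma,\Delta,A\multimap B\vdash C$; $\Gamma\vdash A;\ \Gamma\vdash B\Rightarrow\Gamma\vdash A\& B$; $\Gamma,A\vdash C\Rightarrow\Gamma,A\& B\vdash C$; $\Gamma,B\vdash C\Rightarrow\Gamma,A\& B\vdash C$; $\Gamma\vdash A\Rightarrow\Gamma\vdash A\oplus B$; $\Gamma\vdash B\Rightarrow\Gamma\vdash A\oplus B$; $\Gamma,A\vdash C;\ \Gamma,B\vdash C\Rightarrow\Gamma,A\oplus B\vdash C$; $\Gamma\vdash A\Rightarrow\Gamma\vdash\forall xA$; $\Gamma,A[t/x]\vdash C\Rightarrow\Gamma,\forall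 xA\vdash C$; $\Gamma\vdash A[t/x]\Rightarrow\Gamma\vdash\exists xA$; $\Gamma,A\vdash C\Rightarrow\Gamma,\exists xA\vdash C$ (usual eigenvariable conditions); $\Gamma,!A,!A\vdash C\Rightarrow\Gamma,!A\vdash C$; $\Gamma\vdash C\Rightarrow\Gamma,!A\vdash C$; $!\Gamma\vdash A\Rightarrow\,!\Gamma\vdash\,!A$; $\Gamma,A\vdash C\Rightarrow\Gamma,!A\vdash C$. $\mathsf{ILL}_\bot$ extends $\mathsf{ILL}$ by one more constant $\bot$ (also counted as atomic); its sequents have at most one formula on the right (so $C$ in the rules above may be absent), and it has the additional axiom $\bot\vdash$ and rule $\Gamma\vdash\ \Rightarrow\Gamma\vdash\bot$. $\neg A:=A\multimap\bot$ and $?A:=\neg\,!\,\neg A$. $\mathsf{PRO}$: $A\vdash\,!A$; $\mathsf{DNE}$: $\neg\neg A\vdash A$ (axiom schemas). $\mathsf{CLL}_{\rm b}:=\mathsf{ILL}_\bot+\mathsf{DNE}$; $\mathsf{CL}_{\rm b}:=\mathsf{ILL}_\bot+\mathsf{PRO}+\mathsf{DNE}$. Formulas $A,B$ are provably equivalent in $S$ if $S$ proves $(A\multimap B)\&(B\multimap A)$. Gödel-Gentzen translation: $P^{\rm G}:=\neg\neg P$ ($P$ atomic); $(A\,\square\,B)^{\rm G}:=A^{\rm G}\,\square\,B^{\rm G}$ for $\square\in\{\otimes,\&,\multimap\}$; $(A\oplus B)^{\rm G}:=\neg\neg(A^{\rm G}\oplus B^{\rm G})$; $(\forall xA)^{\rm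 G}:=\forall xA^{\rm G}$; $(\exists xA)^{\rm G}:=\neg\neg\exists xA^{\rm G}$; $(!A)^{\rm G}:=\,!A^{\rm G}$. Call-by-name translation: $A^\circ:=\,!A_\circ$ where $P_\circ:=P$ ($P$ atomic); $(A\otimes B)_\circ:=\,!A_\circ\otimes\,!B_\circ$; $(A\& B)_\circ:=A_\circ\& B_\circ$; $(A\oplus B)_\circ:=\,!A_\circ\oplus\,!B_\circ$; $(A\multimap B)_\circ:=\,!A_\circ\multimap B_\circ$; $(\forall xA)_\circ:=\forall xA_\circ$; $(\exists xA)_\circ:=\exists x\,!A_\circ$; $(!A)_\circ:=\,!A_\circ$. *)

(* Defs.v *)
From Stdlib Require Import List Permutation.
From Stdlib Require Vector.
Import ListNotations.

Set Implicit Arguments.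
Unset Strict Implicit.
Unset Printing Implicit Defensive.

Record signature := Signature {
  fun_sym : Type;
  fun_ar : fun_sym -> nat;
  pred_sym : Type;
  pred_ar : pred_sym -> nat
}.

(* Variables are de Bruijn indices, so that formulas are taken up to renaming
   of bound variables. *)
Inductive term (L : signature) : Type :=
| Var : nat -> term L
| App : forall f : fun_sym L, Vector.t (term L) (fun_ar f) -> term L.
Arguments Var {L} n.
Arguments App {L} f v.

Inductive atom (L : signature) : Type :=
| Rel : forall p : pred_sym L, Vector.t (term L) (pred_ar p) -> atom L
| One : atom L
| Top : atom L
| Zero : atom L
| Bot : atom L.
Arguments Rel {L} p v.
Arguments One {L}.
Arguments Top {L}.
Arguments Zero {L}.
Arguments Bot {L}.

Inductive formula (L : signature) : Type :=
| Atom : atom L -> formula L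
| Tensor : formula L -> formula L -> formula L
| With : formula L -> formula L -> formula L
| Plus : formula L -> formula L -> formula L
| Lolli : formula L -> formula L -> formula L
| All : formula L -> formula L
| Ex : formula L -> formula L
| Bang : formula L -> formula L.

Definition neg (L : signature) (A : formula L) : formula L :=
  Lolli A (Atom Bot).

Definition whynot (L : signature) (A : formula L) : formula L :=
  neg (Bang (neg A)).

Fixpoint subst_term (L : signature) (s : nat -> term L) (t : term L) : term L :=
  match t with
  | Var n => s n
  | App f v => App f (Vector.map (subst_term s) v)
  end.

Definition subst_atom (L : signature) (s : nat -> term L) (a : atom L) : atom L :=
  match a with
  | Rel p v => Rel p (Vector.map (subst_term s) v)
  | One => One
  | Top => Top
  | Zero => Zero
  | Bot => Bot
  end.

Definition shift_subst (L : signature) (n : nat) : term L := Var (S n).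

Definition up (L : signature) (s : nat -> term L) (n : nat) : term L :=
  match n with
  | 0 => Var 0
  | S m => subst_term (@shift_subst L) (s m)
  end.

Fixpoint subst (L : signature) (s : nat -> term L) (A : formula L) : formula L :=
  match A with
  | Atom a => Atom (subst_atom s a)
  | Tensor B C => Tensor (subst s B) (subst s C)
  | With B C => With (subst s B) (subst s C)
  | Plus B C => Plus (subst s B) (subst s C)
  | Lolli B C => Lolli (subst s B) (subst s C)
  | All B => All (subst (up s) B)
  | Ex B => Ex (subst (up s) B)
  | Bang B => Bang (subst s B)
  end.

Definition shift (L : signature) (A : formula L) : formula L :=
  subst (@shift_subst L) A.

(* [inst A t] is A[t/x], where x is the variable of index 0, bound by the
   quantifier in [All A] or [Ex A]. *)
Definition inst (L : signature) (A : formula L) (t : term L) : formula L :=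
  subst (fun n => match n with 0 => t | S m => Var m end) A.

Definition axiom_schema (L : signature) := formula L -> formula L -> Prop.

(* [proves X Gamma C] : the sequent Gamma |- C is derivable in ILL_bot
   extended with the axioms A |- B for all A, B such that [X A B].  Contexts
   are multisets, hence the exchange rule; a right-hand side is [Some C], or
   [None] if it is empty.  In [p_all_r] and [p_ex_l] the eigenvariable is the
   index 0, and shifting the rest of the sequent makes it fresh there. *)
Inductive proves (L : signature) (X : axiom_schema L) :
    list (formula L) -> option (formula L) -> Prop :=
| p_schema A B : X A B -> proves X [A] (Some B)
| p_exchange G D C : Permutation G D -> proves X G C -> proves X D C
| p_id A : proves X [A] (Some A)
| p_cut G D A C :
    proves X G (Some A) -> proves X (A :: D) C -> proves X (G ++ D) C
| p_one_r : proves X [] (Some (Atom One))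
| p_one_l G C : proves X G C -> proves X (Atom One :: G) C
| p_top_r G : proves X G (Some (Atom Top))
| p_zero_l G C : proves X (Atom Zero :: G) C
| p_bot_l : proves X [Atom Bot] None
| p_bot_r G : proves X G None -> proves X G (Some (Atom Bot))
| p_tensor_r G D A B :
    proves X G (Some A) -> proves X D (Some B) ->
    proves X (G ++ D) (Some (Tensor A B))
| p_tensor_l G A B C :
    proves X (A :: B :: G) C -> proves X (Tensor A B :: G) C
| p_lolli_r G A B :
    proves X (A :: G) (Some B) -> proves X G (Some (Lolli A B))
| p_lolli_l G D A B C :
    proves X G (Some A) -> proves X (B :: D) C ->
    proves X (Lolli A B :: G ++ D) C
| p_with_r G A B :
    proves X G (Some A) -> proves X G (Some B) ->
    proves X G (Some (With A B))
| p_with_l1 G A B C : proves X (A :: G) C -> proves X (With A B :: G) C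
| p_with_l2 G A B C : proves X (B :: G) C -> proves X (With A B :: G) C
| p_plus_r1 G A B : proves X G (Some A) -> proves X G (Some (Plus A B))
| p_plus_r2 G A B : proves X G (Some B) -> proves X G (Some (Plus A B))
| p_plus_l G A B C :
    proves X (A :: G) C -> proves X (B :: G) C ->
    proves X (Plus A B :: G) C
| p_all_r G A :
    proves X (List.map (@shift L) G) (Some A) -> proves X G (Some (All A))
| p_all_l G A t C : proves X (inst A t :: G) C -> proves X (All A :: G) C
| p_ex_r G A t : proves X G (Some (inst A t)) -> proves X G (Some (Ex A))
| p_ex_l G A C :
    proves X (A :: List.map (@shift L) G) (option_map (@shift L) C) ->
    proves X (Ex A :: G) C
| p_contraction G A C :
    proves X (Bang A :: Bang A :: G) C -> proves X (Bang A :: G) C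
| p_weakening G A C : proves X G C -> proves X (Bang A :: G) C
| p_promotion G A :
    proves X (List.map (@Bang L) G) (Some A) ->
    proves X (List.map (@Bang L) G) (Some (Bang A))
| p_dereliction G A C : proves X (A :: G) C -> proves X (Bang A :: G) C.

Inductive DNE (L : signature) : axiom_schema L :=
| dne A : DNE (neg (neg A)) A.

Inductive PRO (L : signature) : axiom_schema L :=
| pro A : PRO A (Bang A).

Definition CLLb (L : signature) : list (formula L) -> option (formula L) -> Prop :=
  proves (@DNE L).

Definition CLb (L : signature) : list (formula L) -> option (formula L) -> Prop :=
  proves (fun A B => PRO A B \/ DNE A B).

Definition provably_equivalent (L : signature)
    (T : list (formula L) -> option (formula L) -> Prop) (A B : formula L) : Prop :=
  T [] (Some (With (Lolli A B) (Lolli B A))).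

(* A^G *)
Fixpoint goedel_gentzen (L : signature) (A : formula L) : formula L :=
  match A with
  | Atom a => neg (neg (Atom a))
  | Tensor B C => Tensor (goedel_gentzen B) (goedel_gentzen C)
  | With B C => With (goedel_gentzen B) (goedel_gentzen C)
  | Plus B C => neg (neg (Plus (goedel_gentzen B) (goedel_gentzen C)))
  | Lolli B C => Lolli (goedel_gentzen B) (goedel_gentzen C)
  | All B => All (goedel_gentzen B)
  | Ex B => neg (neg (Ex (goedel_gentzen B)))
  | Bang B => Bang (goedel_gentzen B)
  end.

(* A_o, with the circle as a subscript *)
Fixpoint cbn_sub (L : signature) (A : formula L) : formula L :=
  match A with
  | Atom a => Atom a
  | Tensor B C => Tensor (Bang (cbn_sub B)) (Bang (cbn_sub C))
  | With B C => With (cbn_sub B) (cbn_sub C)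
  | Plus B C => Plus (Bang (cbn_sub B)) (Bang (cbn_sub C))
  | Lolli B C => Lolli (Bang (cbn_sub B)) (cbn_sub C)
  | All B => All (cbn_sub B)
  | Ex B => Ex (Bang (cbn_sub B))
  | Bang B => Bang (cbn_sub B)
  end.

(* A^o, with the circle as a superscript *)
Definition call_by_name (L : signature) (A : formula L) : formula L :=
  Bang (cbn_sub A).

(* A_{Go} *)
Fixpoint gg_cbn_sub (L : signature) (A : formula L) : formula L :=
  match A with
  | Atom a => whynot (Bang (Atom a))
  | Tensor B C => Tensor (Bang (gg_cbn_sub B)) (Bang (gg_cbn_sub C))
  | With B C => With (gg_cbn_sub B) (gg_cbn_sub C)
  | Plus B C => whynot (Plus (Bang (gg_cbn_sub B)) (Bang (gg_cbn_sub C)))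
  | Lolli B C => Lolli (Bang (gg_cbn_sub B)) (gg_cbn_sub C)
  | All B => All (gg_cbn_sub B)
  | Ex B => whynot (Ex (Bang (gg_cbn_sub B)))
  | Bang B => Bang (gg_cbn_sub B)
  end.

(* Main.v *)
(** The translation [A_o] turns [neg (neg A)] into [whynot (Bang A_o)] on the
    nose, so the two translations agree literally on atoms and differ only by
    an extra [!] under [?] in the clauses for [Plus] and [Ex].  That [!] can be
    inserted and removed because [!A + !B] and [Ex x, !A] each entail their own
    [!].  Since every connective is monotone (or antitone) for entailment, the
    equivalence of [(A^G)_o] and [A_Go] follows by induction on [A]. *)
From Stdlib Require Import List Permutation.
Import ListNotations.
Require Import Defs.

Set Implicit Arguments.
Unset Strict Implicit.

(* The automatic induction principle of [term] has no hypothesis for the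
   arguments of a function symbol, hence the explicit recursion. *)
Fixpoint subst_term_cancel (L : signature) (s r : nat -> term L)
    (sr : forall n, exists2 k, r n = Var k & s k = Var n) (t : term L) :
  subst_term s (subst_term r t) = t.
Proof.
  destruct t as [n | f v]; simpl.
  - destruct (sr n) as [k -> sk]. exact sk.
  - f_equal. induction v as [| t m v IHv]; simpl.
    + reflexivity.
    + f_equal.
      * exact (subst_term_cancel L s r sr t).
      * exact IHv.
Qed.

Lemma subst_atom_cancel (L : signature) (s r : nat -> term L) (a : atom L) :
  (forall n, exists2 k, r n = Var k & s k = Var n) ->
  subst_atom s (subst_atom r a) = a.
Proof.
  intros sr. destruct a as [p v | | | |]; simpl; trivial.
  f_equal. induction v as [| t m v IHv]; simpl; trivial.
  now rewrite subst_term_cancel, IHv.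
Qed.

(** Taking [r] to be a renaming lets the hypothesis pass under a binder by computation alone; for an
    arbitrary [r], composition laws for substitutions would be required. *)
Lemma up_cancel (L : signature) (s r : nat -> term L) :
  (forall n, exists2 k, r n = Var k & s k = Var n) ->
  forall n, exists2 k, up r n = Var k & up s k = Var n.
Proof.
  intros sr [| n].
  - now exists 0.
  - destruct (sr n) as [k rn sk]. exists (S k); simpl.
    + now rewrite rn.
    + now rewrite sk.
Qed.

Lemma subst_cancel (L : signature) (A : formula L) (s r : nat -> term L) :
  (forall n, exists2 k, r n = Var k & s k = Var n) ->
  subst s (subst r A) = A.
Proof.
  revert s r.
  induction A as [a | A IHA B IHB | A IHA B IHB | A IHA B IHB | A IHA B IHB
                 | A IHA | A IHA | A IHA]; simpl; intros s r sr;
    f_equal; auto using subst_atom_cancel, up_cancel.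
Qed.

(** Serves the quantifier rules: shifting a sequent turns a quantified body into its image under
    [up shift_subst], and instantiating that at the eigenvariable restores the body. *)
Lemma inst_up_shift (L : signature) (A : formula L) :
  inst (subst (up (@shift_subst L)) A) (Var 0) = A.
Proof.
  apply subst_cancel. intros [| n].
  - now exists 0.
  - now exists (S (S n)).
Qed.

Definition entails (L : signature) (X : axiom_schema L) (A B : formula L) :
  Prop := proves X [A] (Some B).

Section Entailment.

Variables (L : signature) (X : axiom_schema L).
Implicit Types A B C : formula L.

Lemma entails_trans A B C : entails X A B -> entails X B C -> entails X A C.
Proof. intros AB BC. exact (p_cut AB BC). Qed.

Lemma tensor_mono A A' B B' :
  entails X A A' -> entails X B B' -> entails X (Tensor A B) (Tensor A' B').
Proof. intros AA' BB'. apply p_tensor_l. exact (p_tensor_r AA' BB'). Qed.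

Lemma with_mono A A' B B' :
  entails X A A' -> entails X B B' -> entails X (With A B) (With A' B').
Proof.
  intros AA' BB'. apply p_with_r.
  - now apply p_with_l1.
  - now apply p_with_l2.
Qed.

Lemma plus_mono A A' B B' :
  entails X A A' -> entails X B B' -> entails X (Plus A B) (Plus A' B').
Proof.
  intros AA' BB'. apply p_plus_l.
  - now apply p_plus_r1.
  - now apply p_plus_r2.
Qed.

Lemma lolli_mono A A' B B' :
  entails X A' A -> entails X B B' -> entails X (Lolli A B) (Lolli A' B').
Proof.
  intros A'A BB'. apply p_lolli_r. eapply p_exchange; [apply perm_swap |].
  exact (p_lolli_l A'A BB').
Qed.

Lemma all_mono A B : entails X A B -> entails X (All A) (All B).
Proof.
  (* The eigenvariable [Var 0] itself is the instance. *)
  intros AB. apply p_all_r. apply (@p_all_l _ _ _ _ (Var 0)).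
  now rewrite inst_up_shift.
Qed.

Lemma ex_mono A B : entails X A B -> entails X (Ex A) (Ex B).
Proof.
  intros AB. apply p_ex_l.
  apply (@p_ex_r _ _ _ (subst (up (@shift_subst L)) B) (Var 0)).
  now rewrite inst_up_shift.
Qed.

Lemma bang_elim A : entails X (Bang A) A.
Proof. apply p_dereliction, p_id. Qed.

(** This is promotion, [[Bang A]] being [map Bang [A]]. *)
Lemma bang_lift A B : entails X (Bang A) B -> entails X (Bang A) (Bang B).
Proof. exact (@p_promotion L X [A] B). Qed.

Lemma bang_mono A B : entails X A B -> entails X (Bang A) (Bang B).
Proof. intros AB. now apply bang_lift, p_dereliction. Qed.

Lemma whynot_mono A B : entails X A B -> entails X (whynot A) (whynot B).
Proof.
  intros AB. apply lolli_mono; [| apply p_id].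
  apply bang_mono. apply lolli_mono; [exact AB | apply p_id].
Qed.

(** The context must be decomposed first: only then is it a single banged formula, to which
    promotion applies. *)
Lemma plus_bang_intro A B :
  entails X (Plus (Bang A) (Bang B)) (Bang (Plus (Bang A) (Bang B))).
Proof.
  apply p_plus_l; apply bang_lift.
  - apply p_plus_r1, p_id.
  - apply p_plus_r2, p_id.
Qed.

Lemma ex_bang_intro A : entails X (Ex (Bang A)) (Bang (Ex (Bang A))).
Proof.
  apply p_ex_l. apply bang_lift.
  (* The conclusion was shifted by the left rule, hence the body under [up]; the witness is the
     eigenvariable. *)
  apply (@p_ex_r _ _ _ (subst (up (@shift_subst L)) (Bang A)) (Var 0)).
  rewrite inst_up_shift. apply p_id.
Qed.

(** Both directions go through one induction because [Lolli] is antitone on the left, so each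
    direction calls on the other for the antecedent. *)
Lemma cbn_gg_entails A :
  entails X (cbn_sub (goedel_gentzen A)) (gg_cbn_sub A) /\
  entails X (gg_cbn_sub A) (cbn_sub (goedel_gentzen A)).
Proof.
  induction A as [a | A [A1 A2] B [B1 B2] | A [A1 A2] B [B1 B2]
                 | A [A1 A2] B [B1 B2] | A [A1 A2] B [B1 B2]
                 | A [A1 A2] | A [A1 A2] | A [A1 A2]]; simpl.
  - split; apply p_id.
  - split; apply tensor_mono; now apply bang_mono.
  - split; now apply with_mono.
  - split; apply whynot_mono.
    + eapply entails_trans; [apply bang_elim |].
      apply plus_mono; now apply bang_mono.
    + eapply entails_trans; [| apply plus_bang_intro].
      apply plus_mono; now apply bang_mono.
  - split; apply lolli_mono; trivial; now apply bang_mono.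
  - split; now apply all_mono.
  - split; apply whynot_mono.
    + eapply entails_trans; [apply bang_elim |].
      apply ex_mono. now apply bang_mono.
    + eapply entails_trans; [| apply ex_bang_intro].
      apply ex_mono. now apply bang_mono.
  - split; now apply bang_mono.
Qed.

End Entailment.

Theorem theorem1 (L : signature) (A : formula L) :
  provably_equivalent (@CLLb L)
    (call_by_name (goedel_gentzen A)) (Bang (gg_cbn_sub A)).
Proof.
  destruct (cbn_gg_entails (@DNE L) A) as [A1 A2].
  apply p_with_r; apply p_lolli_r; now apply bang_mono.
Qed.
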